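(* Let $n\ge2$, let $B\in\mathsf{SL}(n)$, let $M$ be a nilpotent real $n\times n$ matrix, and let $A(t)=B(I+tM)$, which is a (linear) geodesic in $\mathsf{SL}(n)$ with the HS metric. Let $J(t)$ be a Jacobi field along $A(t)$, and denote by $\dot J=\frac{D}{dt}J$ its first covariant derivative along $A$. Then $|\dot J|$ is bounded for all time, and $|J(t)|$ grows at most linearly in $t$.
   Context: $\mathcal{M}(n)$ is the space of real $n\times n$ matrices with the Hilbert-Schmidt inner product $\langle A,B\rangle=\operatorname{tr}(AB^T)$ and norm $|A|=\sqrt{\langle A,A\rangle}$. The HS metric on $\mathsf{SL}(n)=\{A\in\mathcal{M}(n):\det A=1\}$ is the Riemannian metric induced on it as a submanifold of the Euclidean space $\mathcal{M}(n)$. Jacobi fields and the covariant derivative $\frac{D}{dt}$ along $A$ are those of the Levi-Civita connection of the HS metric on $\mathsf{SL}(n)$. Explicitly, a Jacobi field along $A$ is an $\mathsf{SL}(n)$-tangent vector field $J$ along $A$ with $\frac{D^2J}{dt^2}=R(J,A')A'$, where the curvature is normalized so that $\langle R(X,Y)Z,W\rangle=\mathrm{II}(X,Z)\mathrm{II}(Y,W)-\mathrm{II}(Y,Z)\mathrm{II}(X,W)$ with $\mathrm{II}(X,Y)=\operatorname{tr}(A^{-1}XA^{-1}Y)/|A^{-1}|$; equivalently, $J$ is the variation field of a one-parameter family of geodesics containing $A$. *)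

(* Defs.v *)
From HB Require Import structures.
From mathcomp Require Import all_boot all_order all_algebra.
From mathcomp Require Import all_classical all_reals all_analysis.

Set Implicit Arguments.
Unset Strict Implicit.
Unset Printing Implicit Defensive.

Import Order.TTheory GRing.Theory Num.Theory numFieldNormedType.Exports.
Local Open Scope ring_scope.

Section HSMetric.
Variables (R : realType) (n : nat).
Implicit Types (A B M X Y Z W : 'M[R]_n).

Definition hs_inner X Y : R := \tr (X *m Y^T).

(* The ambient norm `|X| of the library on matrices is the sup norm; it is only
   used through the (norm independent) derivative of matrix-valued curves. *)
Definition hs_norm X : R := Num.sqrt (hs_inner X X).

Definition nilpotent_mx M : Prop := exists k : nat, M ^+ k = 0.

Definition in_SL A : Prop := \det A = 1.

(* T_A SL(n), the kernel of the differential of \det at A *)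
Definition tangent A X : Prop := \tr (invmx A *m X) = 0.

(* The gradient of \det at A in SL(n) is A^{-T}. *)
Definition unit_normal A : 'M[R]_n := (hs_norm (invmx A))^-1 *: (invmx A)^T.

Definition tproj A X : 'M[R]_n := X - hs_inner X (unit_normal A) *: unit_normal A.

Definition second_ff A X Y : R :=
  \tr (invmx A *m X *m invmx A *m Y) / hs_norm (invmx A).

(* V = R(X, Y)Z at the point A, defined by its inner products with T_A SL(n).
   With this sign, <R(X, Y)Y, X> is minus the sectional curvature when X, Y are
   orthonormal. *)
Definition is_curvature A X Y Z V : Prop :=
  tangent A V /\
  forall W, tangent A W ->
    hs_inner V W = second_ff A X Z * second_ff A Y W
                 - second_ff A Y Z * second_ff A X W.

(* Levi-Civita covariant derivative along the curve A of a tangent field J: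
   since SL(n) carries the metric induced from the Euclidean space of matrices,
   it is the tangential component of the ordinary derivative of J. *)
Definition covD (A J : R -> 'M[R]_n) (t : R) : 'M[R]_n :=
  tproj (A t) (derive1 J t).

Definition is_geodesic (A : R -> 'M[R]_n) : Prop :=
  [/\ forall t, in_SL (A t),
      forall t, derivable A t 1,
      forall t, derivable (derive1 A) t 1
    & forall t, covD A (derive1 A) t = 0].

(* The equation D^2J/dt^2 = R(J, A')A' carries no minus sign because of the sign
   convention of is_curvature. *)
Definition is_jacobi_field (A J : R -> 'M[R]_n) : Prop :=
  [/\ forall t, tangent (A t) (J t),
      forall t, derivable J t 1,
      forall t, derivable (covD A J) t 1
    & forall t, is_curvature (A t) (J t) (derive1 A t) (derive1 A t)
                             (covD A (covD A J) t)].

Lemma hs_norm_gt0 X : X != 0 -> 0 < hs_norm X.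
Proof.
have E : hs_inner X X = \sum_i \sum_j X i j ^+ 2.
  by apply: eq_bigr => i _; rewrite mxE; apply: eq_bigr => j _; rewrite mxE expr2.
move=> X0; rewrite sqrtr_gt0 lt0r E; apply/andP; split; last first.
  by apply: sumr_ge0 => i _; apply: sumr_ge0 => j _; exact: sqr_ge0.
apply: contra X0 => /eqP E0; apply/eqP/matrixP => i j; rewrite mxE.
have H i' : 0 <= \sum_j X i' j ^+ 2 by apply: sumr_ge0 => ? _; exact: sqr_ge0.
have /eqP := psumr_eq0P (fun i' _ => H i') E0 (i := i) isT.
move=> /eqP /(psumr_eq0P (fun j' _ => sqr_ge0 (X i j'))) /(_ j isT) /eqP.
by rewrite sqrf_eq0 => /eqP.
Qed.

Lemma hs_norm_sqr X : hs_norm X ^+ 2 = hs_inner X X.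
Proof.
rewrite sqr_sqrtr //; apply: sumr_ge0 => i _; rewrite mxE.
by apply: sumr_ge0 => j _; rewrite mxE -expr2 sqr_ge0.
Qed.

Lemma invmx_SL_neq0 A : (0 < n)%N -> in_SL A -> invmx A != 0.
Proof.
move=> n0 detA; apply/eqP => A0.
have : \det (invmx A) = 0 by rewrite A0 -(scale0r 0) detZ expr0n eqn0Ngt n0 mul0r.
by rewrite det_inv detA invr1 => /eqP; rewrite oner_eq0.
Qed.

Lemma tproj_tangent A X : (0 < n)%N -> in_SL A -> tangent A (tproj A X).
Proof.
move=> n0 /(invmx_SL_neq0 n0) /hs_norm_gt0 /lt0r_neq0 N0.
set h := hs_norm (invmx A) in N0 *.
have EX : hs_inner X (unit_normal A) = h^-1 * \tr (invmx A *m X).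
  rewrite /hs_inner /unit_normal -/h [(_ *: _)^T]linearZ /= trmxK.
  by rewrite -scalemxAr mxtraceZ mxtrace_mulC.
have EN : \tr (invmx A *m unit_normal A) = h.
  rewrite /unit_normal -/h -scalemxAr mxtraceZ -/(hs_inner _ _) -hs_norm_sqr.
  by rewrite -/h expr2 mulKf.
rewrite /tangent /tproj mulmxBr -scalemxAr raddfB /= mxtraceZ EX EN.
by rewrite mulrAC mulVf // mul1r subrr.
Qed.

Lemma tproj_orthogonal A X W :
  tangent A W -> hs_inner (X - tproj A X) W = 0.
Proof.
rewrite /tangent /tproj opprB addrC subrK /hs_inner => W0.
rewrite /unit_normal -!scalemxAl !mxtraceZ -trmx_mul mxtrace_tr.
rewrite [\tr (W *m _)]mxtrace_mulC W0.
by rewrite !mulr0.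
Qed.

End HSMetric.

(* Main.v *)
(* Along A(t) = B (I + t M) the inverse A^-1 = (I + t M)^-1 B^-1 is a polynomial in t, of
   degree exactly k, where M^k <> 0 = M^(k+1). Since II(A', A') = 0, the Jacobi equation
   becomes <J'', W> = phi(J) phi(W) with phi = II(A', .). As phi pairs W with minus the
   derivative of A^-1 divided by |A^-1|, and tangent vectors are orthogonal to A^-T, one
   may add a multiple of A^-1 that cancels the leading term, so |phi(W)| <= C |W| / (1 + t^2).
   The energy |J - t J'|^2 + |J'|^2 then has derivative at most C times itself divided by
   1 + t^2, which is integrable, hence it stays bounded. *)

Require Import Defs.
From HB Require Import structures.
From mathcomp Require Import all_boot all_order all_algebra.
From mathcomp Require Import all_classical all_reals all_analysis.
From mathcomp Require Import ring lra.

Import Order.TTheory GRing.Theory Num.Theory numFieldNormedType.Exports.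
Local Open Scope ring_scope.
Set Implicit Arguments.
Unset Strict Implicit.
Unset Printing Implicit Defensive.

(** * Nilpotent matrices: characteristic polynomial, trace and determinant *)

(** Since [M ^+ k = 0], the matrix ['X%:M - N] divides ['X ^+ k] times the identity. Taking
    determinants, [char_poly M] divides a power of ['X]; being monic it is itself a power of ['X],
    and its size fixes the exponent. *)
Lemma char_poly_nilpotent (F : fieldType) n (M : 'M[F]_n) k :
  M ^+ k = 0 -> char_poly M = 'X^n.
Proof.
move=> Mk; pose N := map_mx polyC M.
have NE j : N ^+ j = map_mx polyC (M ^+ j).
  elim: j => [|j IHj]; first by rewrite !expr0 map_mx1.
  by rewrite !exprS IHj -!mulmxE map_mxM.
have Nk : N ^+ k = 0 by rewrite NE Mk map_mx0.
have /(congr1 determinant) : ('X%:M : 'M[{poly F}]_n) ^+ k = ('X%:M - N) *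
    \sum_(i < k) ('X%:M) ^+ (k.-1 - i) * N ^+ i.
  by rewrite -subrXX_comm ?Nk ?subr0 //; exact: comm_scalar_mx.
rewrite -mulmxE det_mulmx -/(char_poly_mx M) -/(char_poly M).
have -> : ('X%:M : 'M[{poly F}]_n) ^+ k = ('X ^+ k)%:M.
  by elim: (k) => [//|j IHj]; rewrite !exprS IHj -mulmxE scalar_mxM.
rewrite det_scalar -exprM.
move=> e; have : char_poly M %| ('X - 0%:P) ^+ (k * n).
  by rewrite subr0 e dvdp_mulr.
case/dvdp_exp_XsubCP => j _; rewrite subr0 eqp_monic ?monicXn ?char_poly_monic //.
move=> /eqP cE; have := size_char_poly M.
by rewrite cE size_polyXn => -[->].
Qed.

Lemma mxtrace_nilpotent (F : fieldType) n (M : 'M[F]_n) k :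
  M ^+ k = 0 -> \tr M = 0.
Proof.
case: n M => [|n] M Mk; first by rewrite /mxtrace big_ord0.
apply: oppr_inj; rewrite -char_poly_trace // (char_poly_nilpotent Mk) coefXn oppr0.
by rewrite eqn_leq ltnn andbF.
Qed.

(** The determinant is the characteristic polynomial of [- M] evaluated at 1. *)
Lemma det_add1_nilpotent (F : fieldType) n (M : 'M[F]_n) k :
  M ^+ k = 0 -> \det (1%:M + M) = 1.
Proof.
move=> Mk; have Nk : (- M) ^+ k = 0 by rewrite exprNn Mk mulr0.
have := congr1 (horner_eval 1) (char_poly_nilpotent Nk).
rewrite /char_poly -det_map_mx /horner_eval hornerXn expr1n => e.
rewrite -[RHS]e; congr (\det _).
apply/matrixP => i j; rewrite !mxE /= /horner_eval.
by rewrite hornerD hornerN hornerC opprK hornerMn hornerX.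
Qed.

(** * The Hilbert-Schmidt inner product *)

Section Inner.
Variables (R : realType) (n : nat).
Implicit Types X Y Z W : 'M[R]_n.

Lemma hs_innerE X Y : hs_inner X Y = \sum_i \sum_j X i j * Y i j.
Proof.
by apply: eq_bigr => i _; rewrite mxE; apply: eq_bigr => j _; rewrite mxE.
Qed.

Lemma hs_innerC X Y : hs_inner X Y = hs_inner Y X.
Proof. by rewrite /hs_inner -mxtrace_tr trmx_mul trmxK. Qed.

Lemma hs_innerDl X Y Z : hs_inner (X + Y) Z = hs_inner X Z + hs_inner Y Z.
Proof. by rewrite /hs_inner mulmxDl raddfD. Qed.

Lemma hs_innerZl a X Z : hs_inner (a *: X) Z = a * hs_inner X Z.
Proof. by rewrite /hs_inner -scalemxAl mxtraceZ. Qed.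

Lemma hs_innerNl X Z : hs_inner (- X) Z = - hs_inner X Z.
Proof. by rewrite /hs_inner mulNmx raddfN. Qed.

Lemma hs_innerDr X Y Z : hs_inner Z (X + Y) = hs_inner Z X + hs_inner Z Y.
Proof. by rewrite hs_innerC hs_innerDl !(hs_innerC Z). Qed.

Lemma hs_innerZr a X Z : hs_inner Z (a *: X) = a * hs_inner Z X.
Proof. by rewrite hs_innerC hs_innerZl (hs_innerC Z). Qed.

Lemma hs_innerNr X Z : hs_inner Z (- X) = - hs_inner Z X.
Proof. by rewrite hs_innerC hs_innerNl (hs_innerC Z). Qed.

Lemma hs_inner0l X : hs_inner 0 X = 0.
Proof. by rewrite /hs_inner mul0mx raddf0. Qed.

Lemma hs_inner_ge0 X : 0 <= hs_inner X X.
Proof. by rewrite -hs_norm_sqr sqr_ge0. Qed.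

Lemma hs_inner_gt0 X : X != 0 -> 0 < hs_inner X X.
Proof. by move=> /hs_norm_gt0 X0; rewrite -hs_norm_sqr exprn_gt0. Qed.

Lemma hs_inner_CS X Y : hs_inner X Y ^+ 2 <= hs_inner X X * hs_inner Y Y.
Proof.
have [->|Y0] := eqVneq Y 0; first by rewrite hs_innerC !hs_inner0l expr0n mulr0.
(* This squared norm equals [hs_inner Y Y] times the difference of the two sides. *)
have := hs_inner_ge0 (hs_inner Y Y *: X - hs_inner X Y *: Y).
rewrite hs_innerDl !hs_innerDr !hs_innerNl !hs_innerNr !hs_innerZl !hs_innerZr.
rewrite (hs_innerC Y X); have := hs_inner_gt0 Y0.
move: (hs_inner X X) (hs_inner X Y) (hs_inner Y Y) => a b c c0 h.
rewrite -subr_ge0 -(pmulr_rge0 _ c0); apply: le_trans h _.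
by rewrite le_eqVlt; apply/orP; left; apply/eqP; ring.
Qed.

Lemma hs_inner_add_le X Y :
  hs_inner (X + Y) (X + Y) <= 2 * (hs_inner X X + hs_inner Y Y).
Proof.
have := hs_inner_ge0 (X - Y).
rewrite !hs_innerDl !hs_innerDr !hs_innerNl !hs_innerNr (hs_innerC Y X); lra.
Qed.

Lemma is_derive_hs_inner (X Y : R -> 'M[R]_n) (t : R) :
  derivable X t 1 -> derivable Y t 1 ->
  is_derive t 1 (fun s => hs_inner (X s) (Y s))
    (hs_inner (derive1 X t) (Y t) + hs_inner (X t) (derive1 Y t)).
Proof.
move=> dX dY; rewrite !derive1E (derive_mx dX) (derive_mx dY) !hs_innerE.
have -> : (fun s => hs_inner (X s) (Y s)) =
    \sum_i \sum_j (fun s => X s i j) * (fun s => Y s i j).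
  apply/funext => s; rewrite hs_innerE fct_sumE; apply: eq_bigr => i _.
  by rewrite fct_sumE.
rewrite -big_split /=; apply: is_derive_sum => i.
rewrite -big_split /=; apply: is_derive_sum => j.
have dXij := (derivable_mxP X t 1).1 dX i j.
have dYij := (derivable_mxP Y t 1).1 dY i j.
have hX : is_derive t 1 (fun s => X s i j) _ := DeriveDef dXij erefl.
have hY : is_derive t 1 (fun s => Y s i j) _ := DeriveDef dYij erefl.
apply: (is_derive_eq (is_deriveM hX hY)).
by rewrite !mxE addrC; congr (_ + _); exact: mulrC.
Qed.

Lemma hs_norm_le X c : 0 <= c -> hs_inner X X <= c ^+ 2 -> hs_norm X <= c.
Proof. by move=> c0 h; rewrite -(ger0_norm c0) -sqrtr_sqr ler_wsqrtr. Qed.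

End Inner.

(* [E * exp (- c atan)] and [E * exp (c atan)] are monotone, and [atan] is bounded. *)
Lemma gronwall_atan (R : realType) (E dE : R -> R) (c : R) :
  (forall t : R, is_derive t 1 E (dE t)) -> (forall t, 0 <= E t) -> 0 <= c ->
  (forall t, `|dE t| <= c * E t / (1 + t ^+ 2)) ->
  exists K : R, 0 <= K /\ forall t : R, E t <= K.
Proof.
move=> dEt E0 c0 dE_le; pose G (b : R) := E * (expR \o (b *: (@atan R))).
have dG b (t : R) : is_derive t 1 (G b)
    (expR (b * atan t) * (dE t + b * E t / (1 + t ^+ 2))).
  apply: is_derive_eq => /=; rewrite /GRing.scale /=; ring.
have derG b (t : R) : derivable (G b) t 1 by have := dG b t => -[].
have G_cont b (u v : R) : {within `[u, v], continuous (G b)}%classic.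
  by apply: derivable_within_continuous => s _.
have dGE b (t : R) : derive1 (G b) t =
    expR (b * atan t) * (dE t + b * E t / (1 + t ^+ 2)).
  by rewrite derive1E; have := dG b t => -[].
have atanE (s : R) : `|atan s| <= pi / 2.
  by rewrite ler_norml !ltW ?atan_gtNpi2 ?atan_ltpi2.
(* Comparing with time 0 costs at most a factor [expR (c * (pi / 2))], whichever the sign of [b]. *)
have G_bound t b : `|b| = c -> G b t <= G b 0 -> E t <= E 0 * expR (c * (pi / 2)).
  move=> bc; rewrite /G !fctE /= /GRing.scale /= atan0 mulr0 expR0 mulr1 => h.
  rewrite -(ler_pM2r (expR_gt0 (b * atan t))); apply: le_trans h _.
  rewrite -mulrA -expRD ler_peMr // -[leLHS]expR0 ler_expR.
  have : `|b * atan t| <= c * (pi / 2).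
    by rewrite normrM bc; apply: ler_wpM2l.
  by rewrite ler_norml => /andP[]; lra.
exists (E 0 * expR (c * (pi / 2))); split; first by rewrite mulr_ge0 ?expR_ge0.
(* Forward in time [G (- c)] is nonincreasing; backward in time [G c] is nondecreasing. Either way
   the value at [t] is at most the value at 0. *)
move=> t; have [t0|/ltW t0] := leP 0 t.
- apply: (G_bound _ (- c)); first by rewrite normrN ger0_norm.
  apply: (@ler0_derive1_nincr _ _ 0 t) => // s _; rewrite dGE.
  rewrite pmulr_rle0 ?expR_gt0 //; have := dE_le s.
  by rewrite ler_norml => /andP[_]; rewrite !mulNr; lra.
- apply: (G_bound _ c); first by rewrite ger0_norm.
  apply: (@ger0_derive1_ndecr _ _ t 0) => // s _; rewrite dGE.
  rewrite pmulr_rge0 ?expR_gt0 //; have := dE_le s.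
  by rewrite ler_norml => /andP[+ _]; lra.
Qed.

(** * Matrix-valued polynomial curves *)

Section PolynomialCurves.
Variables (R : realType) (m n : nat).

Definition mxpoly_at (k : nat) (L : nat -> 'M[R]_(m, n)) (t : R) : 'M[R]_(m, n) :=
  \sum_(i < k.+1) t ^+ i *: L i.

(** Here [k] only bounds the degree: the top coefficient may vanish, so sums stay in the class. *)
Definition is_mxpoly (k : nat) (F : R -> 'M[R]_(m, n)) : Prop :=
  exists L, forall t, F t = mxpoly_at k L t.

Lemma is_mxpolyD k F G :
  is_mxpoly k F -> is_mxpoly k G -> is_mxpoly k (fun t => F t + G t).
Proof.
move=> [L FE] [L' GE]; exists (fun i => L i + L' i) => t.
by rewrite FE GE -big_split; apply: eq_bigr => i _; rewrite scalerDr.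
Qed.

Lemma is_mxpoly_monomial k i L :
  (i <= k)%N -> is_mxpoly k (fun t => t ^+ i *: L).
Proof.
move=> ik; exists (fun j => if j == i then L else 0) => t.
rewrite /mxpoly_at (bigD1 (Ordinal (ik : (i < k.+1)%N))) //= eqxx big1 ?addr0 //.
by move=> j; rewrite -val_eqE /= => /negPf ->; rewrite scaler0.
Qed.

Lemma is_mxpoly_sum k N (F : nat -> R -> 'M[R]_(m, n)) :
  (forall i, (i < N)%N -> is_mxpoly k (F i)) ->
  is_mxpoly k (fun t => \sum_(i < N) F i t).
Proof.
elim: N => [_|N IHN hF].
  by exists (fun=> 0) => t; rewrite big_ord0 /mxpoly_at big1 // => i _; rewrite scaler0.
have [L FE] := is_mxpolyD (IHN (fun i iN => hF i (ltnW iN))) (hF N (ltnSn N)).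
by exists L => t; rewrite -FE big_ord_recr.
Qed.

End PolynomialCurves.

Lemma is_mxpolyMr (R : realType) m n p k (F : R -> 'M[R]_(m, n)) (Y : 'M[R]_(n, p)) :
  is_mxpoly k F -> is_mxpoly k (fun t => F t *m Y).
Proof.
move=> [L FE]; exists (fun i => L i *m Y) => t.
by rewrite FE mulmx_suml; apply: eq_bigr => i _; rewrite scalemxAl.
Qed.

(** * Two-sided growth bounds for polynomial curves *)

Section Growth.
Variables (R : realType) (n : nat).
Implicit Types (L : nat -> 'M[R]_n) (F : R -> 'M[R]_n).

Lemma is_mxpoly_upper k F : is_mxpoly k F ->
  exists C : R, 0 <= C /\
    forall t : R, hs_inner (F t) (F t) <= C * (1 + t ^+ 2) ^+ k.
Proof.
move=> [L FE].
suff : exists C : R, 0 <= C /\ forall t : R,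
    let P := \sum_(i < k.+1) t ^+ i *: L i in
    hs_inner P P <= C * (1 + t ^+ 2) ^+ k.
  by case=> C [C0 hC]; exists C; split => // t; rewrite FE; exact: (hC t).
(* Induction on the number of summands, with the exponent [k] of the bound held fixed. *)
elim: {-2}k.+1 (leqnn k.+1) => [_|N IHN Nk].
  by exists 0; split => // t /=; rewrite big_ord0 hs_inner0l mul0r.
have [C [C0 hC]] := IHN (ltnW Nk).
exists (2 * (C + hs_inner (L N) (L N))); split.
  by rewrite mulr_ge0 // addr_ge0 // hs_inner_ge0.
move=> t /=; rewrite big_ord_recr /=; apply: le_trans (hs_inner_add_le _ _) _.
rewrite -mulrA ler_wpM2l // mulrDl lerD //.
rewrite hs_innerZl hs_innerZr mulrA -expr2 mulrC -exprM mulnC exprM.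
apply: ler_wpM2l; first exact: hs_inner_ge0.
apply: (@le_trans _ _ ((1 + t ^+ 2) ^+ N)).
  by rewrite lerXn2r ?nnegrE ?addr_ge0 ?sqr_ge0 // lerDr.
by rewrite ler_weXn2l // lerDl sqr_ge0.
Qed.

(** By compactness: the quotient of the two sides is a continuous function on the interval, and its
    maximum serves as the constant. *)
Lemma mxpoly_lower_itv k L :
  (forall t : R, mxpoly_at k L t != 0) ->
  exists C : R, 0 <= C /\ forall t : R, `|t| <= 1 ->
    (1 + t ^+ 2) ^+ k <= C * hs_inner (mxpoly_at k L t) (mxpoly_at k L t).
Proof.
move=> L0; pose q (t : R) := hs_inner (mxpoly_at k L t) (mxpoly_at k L t).
have q0 t : 0 < q t by apply: hs_inner_gt0.
(* The squared norm is written as a real polynomial so that its continuity is immediate. *)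
pose qp : {poly R} :=
  \sum_(i < k.+1) \sum_(j < k.+1) hs_inner (L i) (L j) *: ('X^i * 'X^j).
have qE t : q t = qp.[t].
  rewrite /q /mxpoly_at horner_sum /hs_inner mulmx_suml raddf_sum.
  apply: eq_bigr => i _; rewrite horner_sum (raddf_sum trmx) mulmx_sumr raddf_sum.
  apply: eq_bigr => j _; rewrite [LHS](hs_innerZl _ _ (_ *: _)) hs_innerZr.
  by rewrite hornerZ hornerM !hornerXn; ring.
pose pp : {poly R} := (1 + 'X^2) ^+ k.
have pE t : pp.[t] = (1 + t ^+ 2) ^+ k.
  by rewrite horner_exp hornerD hornerC hornerXn.
have f_cont : {within `[-1, 1 : R], continuous (fun t => pp.[t] / qp.[t])}%classic.
  apply: continuous_subspaceT => t; apply: cvgM; first exact: continuous_horner.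
  by apply: cvgV; [rewrite -qE gt_eqF | exact: continuous_horner].
have [|c _ cmax] := EVT_max _ f_cont; first by lra.
exists (pp.[c] / qp.[c]); split.
  by rewrite pE -qE divr_ge0 // ?(ltW (q0 c)) // exprn_ge0 // addr_ge0 // sqr_ge0.
move=> t t1; rewrite -/(q t) -ler_pdivrMr // -pE qE; apply: cmax.
by rewrite in_itv /= -ler_norml.
Qed.

(* On [|t| >= 1] the curve is [t ^ k] times the reversed polynomial at [1 / t],
   which does not vanish at [0] because the leading coefficient is nonzero. *)
Lemma mxpoly_lower k L : L k != 0 ->
  (forall t : R, mxpoly_at k L t != 0) ->
  exists C : R, 0 <= C /\ forall t : R,
    (1 + t ^+ 2) ^+ k <= C * hs_inner (mxpoly_at k L t) (mxpoly_at k L t).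
Proof.
move=> Lk L0; pose L' i := L (k - i)%N.
have revE (t : R) : t != 0 -> mxpoly_at k L t = t ^+ k *: mxpoly_at k L' t^-1.
  move=> t0; rewrite /mxpoly_at (reindex_inj rev_ord_inj) /= scaler_sumr.
  apply: eq_bigr => i _; rewrite subSS scalerA; congr (_ *: _).
  rewrite exprVn; apply: (canRL (mulfK (expf_neq0 _ t0))).
  by rewrite -exprD subnK // -ltnS.
have L'0 (t : R) : mxpoly_at k L' t != 0.
  have [->|t0] := eqVneq t 0.
    rewrite /mxpoly_at big_ord_recl expr0 scale1r /L' subn0 big1 ?addr0 //.
    by move=> i _; rewrite exprS mul0r scale0r.
  apply: contraNneq (L0 t^-1) => e; rewrite revE ?invr_eq0 // invrK e scaler0 //.
have [C1 [C10 h1]] := mxpoly_lower_itv L0.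
have [C2 [C20 h2]] := mxpoly_lower_itv L'0.
exists (C1 + C2); split; first by rewrite addr_ge0.
move=> t; have [t1|t1] := leP `|t| 1.
  by apply: le_trans (h1 t t1) _; rewrite ler_wpM2r ?hs_inner_ge0 // lerDl.
have t0 : t != 0 by rewrite -normr_gt0 (lt_trans _ t1).
have t'1 : `|t^-1| <= 1 by rewrite normfV invf_le1 ?(lt_trans _ t1) // ltW.
have := h2 _ t'1; rewrite revE // hs_innerZl hs_innerZr => h.
(* This identity carries the bound at [t^-1] for the reversed polynomial over to [t]. *)
have -> : 1 + t ^+ 2 = t ^+ 2 * (1 + t^-1 ^+ 2) by field.
rewrite exprMn; set Q := hs_inner _ _ in h *.
have -> : (C1 + C2) * (t ^+ k * (t ^+ k * Q)) = (t ^+ 2) ^+ k * ((C1 + C2) * Q).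
  by rewrite -exprM mul2n -addnn exprD; ring.
rewrite ler_wpM2l ?(exprn_ge0 k (sqr_ge0 t)) //; apply: le_trans h _.
by rewrite ler_wpM2r ?hs_inner_ge0 // lerDr.
Qed.

End Growth.

(* The derivative of [sum_i x^i], obtained by differentiating the geometric sum. *)
Lemma geometric_deriv (A : pzRingType) (x : A) N :
  (1 - x) * (\sum_(i < N) x ^+ i *+ i.+1) = \sum_(i < N) x ^+ i - x ^+ N *+ N.
Proof.
elim: N => [|N IHN]; first by rewrite !big_ord0 mulr0 mulr0n subr0.
rewrite !big_ord_recr /= mulrDr IHN mulrBl mul1r mulrnAr -exprS.
by rewrite [x ^+ N *+ N.+1]mulrSr -!addrA addKr.
Qed.

(** * The inverse of [1 + t *: M] and its derivative *)

Section Resolvent.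
Variables (R : realType) (n : nat) (M : 'M[R]_n.+1) (k : nat).
Hypothesis Mk1 : M ^+ k.+1 = 0.

(** The Neumann series of the inverse of [1 + t *: M], which is finite because [M ^+ k.+1 = 0]. *)
Definition resolvent (t : R) : 'M[R]_n.+1 := \sum_(i < k.+1) (- t *: M) ^+ i.

Let MXk t : M * (- t *: M) ^+ k = 0.
Proof. by rewrite exprZn -scalerAr -exprS Mk1 scaler0. Qed.

Lemma resolventK t : (1 + t *: M) * resolvent t = 1.
Proof.
have -> : 1 + t *: M = - (- t *: M - 1) by rewrite opprB scaleNr opprK.
by rewrite mulNr -subrX1 exprZn Mk1 scaler0 sub0r opprK.
Qed.

Lemma resolventKr t : resolvent t * (1 + t *: M) = 1.
Proof. exact: mulmx1C (resolventK t). Qed.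

(* [resolvent * M * resolvent] is minus the derivative of [resolvent]. *)
Lemma resolvent_deriv t :
  resolvent t * M * resolvent t = M * \sum_(i < k) (- t *: M) ^+ i *+ i.+1.
Proof.
set x := - t *: M; set D := \sum_(i < k) _.
have xE : 1 + t *: M = 1 - x by rewrite /x scaleNr opprK.
have xM : M * x = x * M by rewrite /x -scalerAr -scalerAl.
(* In the differentiated geometric sum the boundary term is killed by [M], since [M * x ^+ k = 0];
   for the same reason the term of index [k] can be added to complete [resolvent]. *)
have e : (1 + t *: M) * (M * D) = M * resolvent t.
  rewrite mulrA xE mulrBl mul1r -xM -{1}[M]mulr1 -mulrBr.
  rewrite -mulrA geometric_deriv mulrBr mulrnAr MXk mul0rn subr0.
  by rewrite /resolvent big_ord_recr /= mulrDr MXk addr0.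
by rewrite -mulrA -e mulrA resolventKr mul1r.
Qed.

Lemma is_mxpoly_term i j : (i <= j)%N -> is_mxpoly j (fun t => (- t *: M) ^+ i).
Proof.
move=> ij; have [L LE] := is_mxpoly_monomial ((-1) ^+ i *: M ^+ i) ij.
exists L => t; rewrite -LE exprZn scalerA; congr (_ *: _).
by rewrite -exprMn mulrN1.
Qed.

(* The top coefficients of the two summands cancel, which is why the degree is
   [k] and not [k + 1]. *)
Lemma is_mxpoly_resolvent_deriv : is_mxpoly k (fun t =>
  (1 + t ^+ 2) *: (resolvent t * M * resolvent t) + (k%:R * t) *: resolvent t).
Proof.
have h1 : is_mxpoly k (fun t => \sum_(i < k) (- t *: M) ^+ i *m (M *+ i.+1)).
  apply: (is_mxpoly_sum (F := fun i t => (- t *: M) ^+ i *m (M *+ i.+1))).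
  by move=> i ik; apply: is_mxpolyMr; apply: is_mxpoly_term; exact: ltnW.
(* The curve will be split as [M * D] plus [t] times the sum of the [x ^+ i *+ (k - i)] with
   [x = - t *: M]; both pieces visibly have degree at most [k]. *)
have h2 : is_mxpoly k (fun t =>
    \sum_(i < k) (t *: (- t *: M) ^+ i) *m (1%:M *+ (k - i))).
  apply: (is_mxpoly_sum
    (F := fun i t => (t *: (- t *: M) ^+ i) *m (1%:M *+ (k - i)))).
  move=> i ik; apply: is_mxpolyMr.
  have [L LE] := is_mxpoly_monomial ((-1) ^+ i *: M ^+ i) ik.
  exists L => t; rewrite -LE exprZn !scalerA exprS; congr (_ *: _).
  by rewrite -mulrA -exprMn mulrN1.
have [L LE] := is_mxpolyD h1 h2; exists L => t; rewrite -LE resolvent_deriv.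
set x := - t *: M; set D := \sum_(i < k) x ^+ i *+ i.+1.
have -> : \sum_(i < k) x ^+ i *m (M *+ i.+1) = M * D.
  rewrite mulr_sumr; apply: eq_bigr => i _; rewrite mulmxE !mulrnAr; congr (_ *+ _).
  by rewrite exprZn -scalerAr -scalerAl -exprS -exprSr.
rewrite scalerDl scale1r -addrA; congr (_ + _).
have -> : t ^+ 2 *: (M * D) = t *: (- (x * D)).
  by rewrite /x -scalerAl scaleNr opprK scalerA expr2.
have -> : (k%:R * t) *: resolvent t = t *: (resolvent t *+ k).
  by rewrite mulrC -scalerA scaler_nat.
have -> : x * D = D - (\sum_(i < k) x ^+ i - x ^+ k *+ k).
  by rewrite -geometric_deriv mulrBl mul1r subKr.
have -> : \sum_(i < k) (t *: x ^+ i) *m (1%:M *+ (k - i)) =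
    t *: \sum_(i < k) x ^+ i *+ (k - i).
  rewrite scaler_sumr; apply: eq_bigr => i _.
  by rewrite mulmxE mulrnAr -scalerAl mulr1 scalerMnr.
(* The term [x ^+ k *+ k] of the resolvent cancels the boundary term of the geometric derivative;
   below it the coefficients are [k + 1 - (i + 1) = k - i]. *)
rewrite -scalerDr /resolvent big_ord_recr /= mulrnDl opprB; congr (_ *: _).
rewrite (addrAC _ (- (x ^+ k *+ k))) (addrC (_ *+ k)) addrA subrK.
rewrite -sumrMnl -sumrB -big_split; apply: eq_bigr => i _ /=.
by rewrite mulrnBr 1?ltnW // mulrS opprD addrA subrr sub0r addrC.
Qed.

End Resolvent.

(** * The second fundamental form along the linear curve *)

Section LinearGeodesic.
Variables (R : realType) (n : nat) (B M : 'M[R]_n.+1) (k : nat).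
Hypotheses (hB : in_SL B) (Mk : M ^+ k != 0) (Mk1 : M ^+ k.+1 = 0).

Let A (t : R) : 'M[R]_n.+1 := B *m (1%:M + t *: M).

Let B_unit : B \in unitmx.
Proof. by rewrite unitmxE hB unitr1. Qed.

Let tM_nilpotent t : (t *: M) ^+ k.+1 = 0.
Proof. by rewrite exprZn Mk1 scaler0. Qed.

Lemma linear_curve_SL t : in_SL (A t).
Proof. by rewrite /in_SL det_mulmx hB mul1r (det_add1_nilpotent (tM_nilpotent t)). Qed.

Lemma invmx_linear_curve t : invmx (A t) = resolvent M k t *m invmx B.
Proof.
have A_unit : A t \in unitmx by rewrite unitmxE linear_curve_SL unitr1.
have SK : (1%:M + t *: M) *m resolvent M k t = 1%:M := resolventK Mk1 t.
have e : A t *m (resolvent M k t *m invmx B) = 1%:M.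
  by rewrite /A mulmxA -(mulmxA B) SK mulmx1 mulmxV.
by rewrite -[LHS]mulmx1 -e mulKmx.
Qed.

(** The numerator is the trace of the square of [S * M], where [S] is the resolvent. As [S] commutes
    with [M], this product is nilpotent and the trace vanishes. *)
Lemma second_ff_velocity_velocity t : second_ff (A t) (B *m M) (B *m M) = 0.
Proof.
rewrite /second_ff invmx_linear_curve -!mulmxA !(mulmxA (invmx B)) mulVmx // !mul1mx.
set S := resolvent M k t.
have SM : S * M = M * S.
  have e : (1 + t *: M) * M = M * (1 + t *: M).
    by rewrite mulrDl mulrDr mul1r mulr1 -scalerAl -scalerAr.
  rewrite -[M in LHS]mulr1 -[in LHS](resolventK Mk1 t) -/S !mulrA.
  by rewrite -(mulrA S) -e mulrA resolventKr // mul1r.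
have : (S * M) ^+ k.+1 = 0 by rewrite exprMn_comm // Mk1 mulr0.
move=> SMk.
rewrite (_ : S *m (M *m _) = (S * M) ^+ 2); last first.
  by rewrite expr2 -!mulmxE !mulmxA.
rewrite (mxtrace_nilpotent (k := k.+1)) ?mul0r //.
by rewrite -exprM mulnC exprM SMk expr0n.
Qed.

(* [1 + t ^ 2] times [second_ff] at the velocity pairs [W] with the sum of the
   polynomial curve of [is_mxpoly_resolvent_deriv] and a multiple of [A^-1],
   and the latter pairs to zero with tangent vectors. *)
Lemma second_ff_velocity_bound : exists C : R, 0 <= C /\
  forall (t : R) (W : 'M[R]_n.+1), tangent (A t) W ->
    ((1 + t ^+ 2) * second_ff (A t) (B *m M) W) ^+ 2 <= C * hs_inner W W.
Proof.
pose G t := ((1 + t ^+ 2) *: (resolvent M k t * M * resolvent M k t)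
  + (k%:R * t) *: resolvent M k t) *m invmx B.
have polyG : is_mxpoly k G.
  by apply: is_mxpolyMr; exact: is_mxpoly_resolvent_deriv.
(* The inverse never vanishes, and its top coefficient is, up to sign, [M ^+ k *m invmx B], nonzero
   by [Mk]. *)
have [C1 [C10 lower]] : exists C : R, 0 <= C /\ forall t : R,
    (1 + t ^+ 2) ^+ k <= C * hs_inner (invmx (A t)) (invmx (A t)).
  pose L i : 'M[R]_n.+1 := ((-1) ^+ i *: M ^+ i) *m invmx B.
  have LE t : mxpoly_at k L t = invmx (A t).
    rewrite invmx_linear_curve /resolvent mulmx_suml; apply: eq_bigr => i _.
    by rewrite /L scalemxAl scalerA exprZn -exprMn mulrN1.
  have [|t|C [C0 hC]] := @mxpoly_lower _ _ k L.
  - rewrite /L -scalemxAl scaler_eq0 signr_eq0 /=.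
    apply: contra Mk => /eqP e; rewrite -[M ^+ k]mulmx1 -(mulVmx B_unit) mulmxA.
    by rewrite e mul0mx.
  - by rewrite LE; apply: invmx_SL_neq0 => //; exact: linear_curve_SL.
  - by exists C; split => // t; rewrite -LE.
have [C2 [C20 upper]] := is_mxpoly_upper polyG.
(* After Cauchy-Schwarz, the powers of [1 + t ^+ 2] in the upper bound for [G] and the lower bound
   for the inverse cancel. *)
exists (C2 * C1); split; first by rewrite mulr_ge0.
move=> t W tW; set h2 := hs_inner (invmx (A t)) (invmx (A t)).
have h2_gt0 : 0 < h2.
  by apply/hs_inner_gt0/invmx_SL_neq0 => //; exact: linear_curve_SL.
have -> : (1 + t ^+ 2) * second_ff (A t) (B *m M) W =
    hs_inner W (G t)^T / hs_norm (invmx (A t)).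
  rewrite /second_ff /hs_inner trmxK [\tr (W *m _)]mxtrace_mulC mulrA; congr (_ / _).
  rewrite /G !mulmxDl raddfD /= -!scalemxAl !mxtraceZ.
  move: tW; rewrite /tangent invmx_linear_curve => ->; rewrite mulr0 addr0.
  by rewrite -!mulmxA !(mulmxA (invmx B) B) mulVmx // mul1mx.
rewrite expr_div_n hs_norm_sqr -/h2 ler_pdivrMr //.
apply: le_trans (hs_inner_CS _ _) _.
have -> : hs_inner (G t)^T (G t)^T = hs_inner (G t) (G t).
  by rewrite /hs_inner trmxK mxtrace_mulC.
rewrite mulrC mulrAC ler_wpM2r ?hs_inner_ge0 //.
apply: le_trans (upper t) _; rewrite -mulrA ler_wpM2l //; exact: lower.
Qed.

End LinearGeodesic.

(** * Linearity and tangential testing *)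

Section Tangent.
Variables (R : realType) (n : nat).
Implicit Types A X Y W : 'M[R]_n.

Lemma tangent_sub_scale A X Y a :
  tangent A X -> tangent A Y -> tangent A (X - a *: Y).
Proof.
rewrite /tangent mulmxBr raddfB /= -scalemxAr mxtraceZ => -> ->.
by rewrite mulr0 subr0.
Qed.

Lemma second_ff_sub_scale A X Y W a :
  second_ff A W (X - a *: Y) = second_ff A W X - a * second_ff A W Y.
Proof.
by rewrite /second_ff mulmxBr raddfB /= -scalemxAr mxtraceZ mulrBl mulrA.
Qed.

Lemma second_ffC A X Y : second_ff A X Y = second_ff A Y X.
Proof. by rewrite /second_ff -mulmxA mxtrace_mulC mulmxA. Qed.

(** The discarded normal component is orthogonal to [W]. This lets the Euclidean product rule
    replace that of the connection. *)
Lemma hs_inner_covD (A J : R -> 'M[R]_n) t W :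
  tangent (A t) W -> hs_inner (derive1 J t) W = hs_inner (covD A J t) W.
Proof.
move=> tW; apply/eqP; rewrite -subr_eq0 -hs_innerNl -hs_innerDl.
by rewrite (tproj_orthogonal _ tW).
Qed.

End Tangent.

(** * Energy estimate, with [T], [phi] and [D] standing for tangency, [II(A', .)] and the covariant
    derivative of [J] *)

Section JacobiEnergy.
Variables (R : realType) (n : nat) (T : R -> 'M[R]_n -> Prop).
Variables (phi : R -> 'M[R]_n -> R) (J D : R -> 'M[R]_n) (C : R).
Hypothesis T_sub : forall t X Y a, T t X -> T t Y -> T t (X - a *: Y).
Hypothesis phi_sub : forall t X Y a, phi t (X - a *: Y) = phi t X - a * phi t Y.
Hypothesis phi_le : forall t W, T t W ->
  ((1 + t ^+ 2) * phi t W) ^+ 2 <= C * hs_inner W W.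
Hypothesis JT : forall t, T t (J t).
Hypothesis DT : forall t, T t (D t).
Hypothesis derJ : forall t : R, derivable J t 1.
Hypothesis derD : forall t : R, derivable D t 1.
Hypothesis dJ : forall t W, T t W -> hs_inner (derive1 J t) W = hs_inner (D t) W.
Hypothesis dD : forall t W, T t W ->
  hs_inner (derive1 D t) W = phi t (J t) * phi t W.
Hypothesis C0 : 0 <= C.

(* In flat space [J - t D] and [D] would be constant. *)
Definition jacobi_energy (t : R) : R := hs_inner (J t - t *: D t) (J t - t *: D t)
  + hs_inner (D t) (D t).

Let energyE t : jacobi_energy t = hs_inner (J t) (J t)
  - 2 * (t * hs_inner (J t) (D t)) + (t * t + 1) * hs_inner (D t) (D t).
Proof.
rewrite /jacobi_energy; move: (J t) (D t) => X Y.
rewrite !hs_innerDl !hs_innerDr !hs_innerNl !hs_innerNr.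
by rewrite !hs_innerZl !hs_innerZr (hs_innerC Y X); ring.
Qed.

Let energy_ge0 t : 0 <= jacobi_energy t.
Proof. by rewrite addr_ge0 // hs_inner_ge0. Qed.

Let dE t := 2 * phi t (J t) * ((1 + t ^+ 2) * phi t (D t) - t * phi t (J t)).

Let is_derive_energy (t : R) : is_derive t 1 jacobi_energy (dE t).
Proof.
have dJJ := is_derive_hs_inner (@derJ t) (@derJ t).
have dJD := is_derive_hs_inner (@derJ t) (@derD t).
have dDD := is_derive_hs_inner (@derD t) (@derD t).
(* Only the tangential parts of the derivatives are known, but each is paired with a tangent vector,
   so [dJ] and [dD] evaluate every term. *)
rewrite (hs_innerC (J t) (derive1 J t)) !(dJ (JT t)) in dJJ.
rewrite (hs_innerC (J t) (derive1 D t)) (dJ (DT t)) (dD (JT t)) in dJD.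
rewrite (hs_innerC (D t) (derive1 D t)) !(dD (DT t)) in dDD.
have -> : jacobi_energy = (fun s => hs_inner (J s) (J s))
    - 2 \*: (id * (fun s => hs_inner (J s) (D s)))
    + (id * id + cst 1) * (fun s => hs_inner (D s) (D s)).
  by apply/funext => s; rewrite energyE.
have did := is_derive_id t (1 : R).
have dE1 := is_deriveB dJJ (is_deriveZ 2 (is_deriveM did dJD)).
have dE2 := is_deriveM (is_deriveD (is_deriveM did did) (is_derive_cst (1 : R) t 1)) dDD.
apply: (is_derive_eq (is_deriveD dE1 dE2)).
rewrite (hs_innerC (D t) (J t)) /dE /GRing.scale /=.
rewrite (_ : (id * id + cst 1) t = (t * t + 1 : R)) //.
move: (hs_inner (J t) (D t)) (hs_inner (D t) (D t)) (phi t (J t)) (phi t (D t)) => a b c d.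
ring.
Qed.

Lemma jacobi_energy_bounded : exists K : R, 0 <= K /\ forall t, jacobi_energy t <= K.
Proof.
apply: (gronwall_atan is_derive_energy energy_ge0 C0) => t.
set r := 1 + t ^+ 2; have r0 : 0 < r by rewrite ltr_wpDr ?sqr_ge0.
rewrite ler_pdivlMr //.
(* The bound on [phi] is applied to [J - t D] and to [D], the two vectors whose squared norms make
   up the energy. *)
have := lerD (phi_le (T_sub t (JT t) (DT t))) (phi_le (DT t)).
rewrite -mulrDr -/(jacobi_energy t) -/r phi_sub.
apply: le_trans; rewrite /dE -/r.
set a := phi t (J t); set b := phi t (D t).
have -> : (r * (a - t * b)) ^+ 2 + (r * b) ^+ 2 = r * ((a - t * b) ^+ 2 + b ^+ 2) * r.
  by ring.
(* The right side equals [a ^+ 2 + (r * b - t * a) ^+ 2], while the derivative is twice the product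
   of [a] and [r * b - t * a]; each inequality is thus the nonnegativity of a square. *)
rewrite ler_pM2r // ler_norml /r; apply/andP; split.
  have := sqr_ge0 (a + (r * b - t * a)); rewrite /r; nra.
have := sqr_ge0 (a - (r * b - t * a)); rewrite /r; nra.
Qed.

Lemma covD_le_energy t : hs_inner (D t) (D t) <= jacobi_energy t.
Proof. by rewrite lerDr hs_inner_ge0. Qed.

(** The difference of the two sides is the squared norm of [t *: J t - (1 + t ^+ 2) *: D t]. *)
Lemma jacobi_le_energy t : hs_inner (J t) (J t) <= (1 + t ^+ 2) * jacobi_energy t.
Proof.
rewrite -subr_ge0 energyE; move: (J t) (D t) => X Y.
have := hs_inner_ge0 (t *: X - (1 + t ^+ 2) *: Y).
rewrite !hs_innerDl !hs_innerDr !hs_innerNl !hs_innerNr !hs_innerZl !hs_innerZr.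
by rewrite (hs_innerC Y X); congr (_ <= _); ring.
Qed.

End JacobiEnergy.

(** * Growth of Jacobi fields along linear geodesics *)

Theorem theorem3p9 (R : realType) (n : nat) (hn : (2 <= n)%N)
    (B M : 'M[R]_n) (hB : in_SL B) (hM : nilpotent_mx M)
    (A : R -> 'M[R]_n) (hA : forall t : R, A t = B *m (1%:M + t *: M)) :
  is_geodesic A /\
  forall J : R -> 'M[R]_n, is_jacobi_field A J ->
    (exists C : R, forall t : R, hs_norm (covD A J t) <= C) /\
    (exists C : R, forall t : R, hs_norm (J t) <= C * (1 + `|t|)).
Proof.
case: n hn B M hB hM A hA => [//|n] _ B M hB hM A hA.
(* The least vanishing power of [M] has positive exponent, because [M ^+ 0] is a nonzero identity;
   [k] is its predecessor. *)
have [k Mk Mk1] : exists2 k, M ^+ k != 0 & M ^+ k.+1 = 0.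
  have ex : exists k, M ^+ k == 0 by case: hM => k /eqP ?; exists k.
  case: (ex_minnP ex) => -[|k] /eqP Mk0 kmin.
    by move: Mk0 => /eqP; rewrite expr0 oner_eq0.
  by exists k => //; apply/negP => /kmin; rewrite ltnn.
have {hA} -> : A = fun t => B *m (1%:M + t *: M) by apply/funext.
set A' := fun t => _.
have SL t : in_SL (A' t) by exact: linear_curve_SL Mk1 _.
have dAij i j (t : R) : is_derive t 1 (fun s => A' s i j) ((B *m M) i j).
  have -> : (fun s => A' s i j) = cst (B i j) + (B *m M) i j \*: id.
    apply/funext => s; rewrite /A' mulmxDr mulmx1 -scalemxAr !mxE.
    by rewrite mulrC.
  apply: (is_derive_eq (is_deriveD (is_derive_cst (B i j) t 1)
    (is_deriveZ ((B *m M) i j) (is_derive_id t (1 : R))))).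
  by rewrite add0r; exact: mulr1.
have dA (t : R) : derivable A' t 1.
  by apply/derivable_mxP => i j; have := dAij i j t => -[].
have A'E : derive1 A' = cst (B *m M).
  apply/funext => t; rewrite derive1E (derive_mx (dA t)).
  by apply/matrixP => i j; rewrite mxE; have := dAij i j t => -[].
split.
  split; [exact: SL | exact: dA | |].
  - move=> t; rewrite A'E; exact: derivable_cst.
  - move=> t; rewrite /covD A'E derive1_cst /tproj /hs_inner mul0mx.
    by rewrite raddf0 scale0r subr0.
move=> J [Jt dJ dD curv].
have [C [C0 hC]] := second_ff_velocity_bound hB Mk Mk1.
(* The other curvature term contains the factor [II(A', A') = 0]. *)
have jac t W : tangent (A' t) W -> hs_inner (covD A' (covD A' J) t) W =
    second_ff (A' t) (derive1 A' t) (J t) * second_ff (A' t) (derive1 A' t) W.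
  move=> tW; have [_ ->//] := curv t.
  rewrite A'E [second_ff _ (B *m M) (B *m M)](second_ff_velocity_velocity hB Mk1).
  rewrite mul0r subr0.
  by rewrite second_ffC.
have phi_le t W : tangent (A' t) W ->
    ((1 + t ^+ 2) * second_ff (A' t) (derive1 A' t) W) ^+ 2 <= C * hs_inner W W.
  by rewrite A'E; exact: hC.
have DT t : tangent (A' t) (covD A' J t) by exact: tproj_tangent.
have dJ' t W := @hs_inner_covD _ _ A' J t W.
have dD' t W (tW : tangent (A' t) W) :=
  etrans (hs_inner_covD (covD A' J) tW) (jac t W tW).
have [K [K0 hK]] := jacobi_energy_bounded (fun t => @tangent_sub_scale _ _ (A' t))
  (fun t X Y => second_ff_sub_scale (A' t) X Y (derive1 A' t)) phi_le Jt DT dJ dD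
  dJ' dD' C0.
(* One constant serves both bounds: the energy dominates the squared norm of the covariant
   derivative, and [1 + t ^+ 2] is at most the square of 1 plus the absolute value of [t]. *)
split; exists (Num.sqrt K) => t; apply: hs_norm_le; rewrite ?mulr_ge0 ?sqrtr_ge0 //.
- by rewrite sqr_sqrtr //; apply: le_trans (hK t); exact: covD_le_energy.
- rewrite exprMn sqr_sqrtr // mulrC.
  apply: le_trans (jacobi_le_energy _ _ t) _; apply: ler_pM => //.
  + by rewrite addr_ge0 ?sqr_ge0.
  + by rewrite addr_ge0 ?hs_inner_ge0.
  + by rewrite -real_normK ?num_real //; have := normr_ge0 t; nra.
Qed.
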